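(* Let $f$ be a scalar convection flux and $a$ a scalar diffusion potential. On a uniform 1D mesh of size $\Delta x$ consider the cell-average evolution $$\frac{\mathrm d\bar u_i}{\mathrm dt}+\frac1{\Delta x}\bigl(f(u_{i+\frac12})-f(u_{i-\frac12})\bigr)=\frac1{\Delta x}\bigl((a_x)_{i+\frac12}-(a_x)_{i-\frac12}\bigr),$$ $$(a_x)_{i+\frac12}=\frac1{6\Delta x}\bigl(a_{i-\frac12}-8a_i+8a_{i+1}-a_{i+\frac32}\bigr),$$ where $a_{i\pm\frac12}=a(u_{i\pm\frac12})$ and $a_i=a(u_i)$. With a forward Euler step of size $\Delta t^n$, the cell-average update has the doubly conservative form $$\frac{\widetilde u_i^{n+1}-\widetilde u_i^n}{\Delta t^n}+\frac{\widetilde f_{i+\frac12}^n-\widetilde f_{i-\frac12}^n}{\Delta x}=\frac{\widetilde a_{i+1}^n-2\widetilde a_i^n+\widetilde a_{i-1}^n}{\Delta x^2},$$ with $\widetilde u_i=\bar u_i$, $\widetilde f_{i+\frac12}=f(u_{i+\frac12})$ and $\widetilde a_i=\hat a_i$, where $$\hat a_i=\frac16\bigl(-a_{i-\frac12}+8a_i-a_{i+\frac12}\bigr).$$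
   Context: The scheme is a spatial discretization (active flux method) of $u_t+f(u)_x=a(u)_{xx}$. The mesh consists of uniform cells $I_i=[x_{i-\frac12},x_{i+\frac12}]$ of size $\Delta x$. The degrees of freedom are the cell averages $\bar u_i(t)$ and the point values $u_{i+\frac12}(t)$ at the cell interfaces. The cell-centered value is obtained from Simpson's rule: $u_i=\frac14\bigl(6\bar u_i-(u_{i-\frac12}+u_{i+\frac12})\bigr)$. Doubly conservative form: for a forward Euler step, the update of the cell averages can be written as displayed in the claim, where $\widetilde u_i,\widetilde f_{i+\frac12},\widetilde a_i$ are approximations of the conservative variable, the convection flux $f(u)$ and the diffusion potential $a(u)$. Consistency requires that, for a constant state $u$ (all cell averages and point values equal to $u$), $\widetilde u_i=u$, $\widetilde f_{i+\frac12}=f(u)$ and $\widetilde a_i=a(u)$. *)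

(* Defs.v *)
From HB Require Import structures.
From mathcomp Require Import all_boot all_order all_algebra.
From mathcomp Require Import reals.
Set Implicit Arguments.
Unset Strict Implicit.
Unset Printing Implicit Defensive.
Import Order.TTheory GRing.Theory Num.Theory.
Local Open Scope ring_scope.

(* The cells are indexed by the integers, so there is no boundary.  Interfaces
   are indexed by the cell on their left: [point s i] is u_{i+1/2}, and hence
   u_{i-1/2} is [point s (i - 1)]. *)
Record af_state (R : realType) := AFState {
  average : int -> R;
  point : int -> R
}.

(* u_i, solving Simpson's rule ubar_i = (u_{i-1/2} + 4 u_i + u_{i+1/2}) / 6 *)
Definition center (R : realType) (s : af_state R) (i : int) : R :=
  1 / 4 * (6 * average s i - (point s (i - 1) + point s i)).

(* (a_x)_{i+1/2} *)
Definition diffusion_flux (R : realType) (a : R -> R) (dx : R)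
    (s : af_state R) (i : int) : R :=
  1 / (6 * dx) * (a (point s (i - 1)) - 8 * a (center s i)
                  + 8 * a (center s (i + 1)) - a (point s (i + 1))).

(* The value of d ubar_i / dt prescribed by the semi-discrete evolution. *)
Definition average_rhs (R : realType) (f a : R -> R) (dx : R)
    (s : af_state R) (i : int) : R :=
  - (1 / dx * (f (point s i) - f (point s (i - 1))))
  + 1 / dx * (diffusion_flux a dx s i - diffusion_flux a dx s (i - 1)).

(* Only the averages are constrained: the new point values, which are evolved
   by a separate equation, are left arbitrary. *)
Definition euler_average_step (R : realType) (f a : R -> R) (dx dt : R)
    (s s' : af_state R) : Prop :=
  forall i : int, average s' i = average s i + dt * average_rhs f a dx s i.

(* [tf s i] stands for the convective flux at the interface i+1/2. *)
Definition doubly_conservative_update (R : realType)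
    (tu tf ta : af_state R -> int -> R) (dx dt : R) (s s' : af_state R) : Prop :=
  forall i : int,
    (tu s' i - tu s i) / dt + (tf s i - tf s (i - 1)) / dx
    = (ta s (i + 1) - 2 * ta s i + ta s (i - 1)) / dx ^+ 2.

Definition constant_state (R : realType) (s : af_state R) (u : R) : Prop :=
  forall i : int, average s i = u /\ point s i = u.

Definition consistent (R : realType) (f a : R -> R)
    (tu tf ta : af_state R -> int -> R) : Prop :=
  forall (s : af_state R) (u : R), constant_state s u ->
  forall i : int, [/\ tu s i = u, tf s i = f u & ta s i = a u].

Definition point_flux (R : realType) (f : R -> R)
    (s : af_state R) (i : int) : R := f (point s i).

Definition a_hat (R : realType) (a : R -> R) (s : af_state R) (i : int) : R :=
  1 / 6 * (- a (point s (i - 1)) + 8 * a (center s i) - a (point s i)).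

(* Main.v *)
(* The fourth-order interface flux is a plain difference of neighbouring values
   of [a_hat], [dx (a_x)_{i+1/2} = a_hat_{i+1} - a_hat_i], because the
   contributions of the shared interface value [a_{i+1/2}] cancel; the flux
   difference is then the second difference of [a_hat]. *)
Require Import Defs.
From HB Require Import structures.
From mathcomp Require Import all_boot all_order all_algebra.
From mathcomp Require Import reals.
From mathcomp Require Import ring.
Import Order.TTheory GRing.Theory Num.Theory.
Local Open Scope ring_scope.

Lemma diffusion_flux_a_hat (R : realType) (a : R -> R) (dx : R)
    (s : af_state R) (i : int) :
  dx != 0 ->
  diffusion_flux a dx s i = (a_hat a s (i + 1) - a_hat a s i) / dx.
(* [addrK] turns the index [i + 1 - 1] into [i], so that [field] sees the shared interface value as
   one term. *)
Proof. by move=> dx0; rewrite /diffusion_flux /a_hat addrK; field. Qed.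

(** The weights of [center], (6 - 1 - 1) / 4, and then those of [a_hat], (-1 + 8 - 1) / 6, sum to
    1. *)
Lemma a_hat_consistent (R : realType) (f a : R -> R) :
  consistent f a (@average R) (point_flux f) (a_hat a).
Proof.
move=> s u su i; have [avg_u pt_u] := su i; have [_ pt_u'] := su (i - 1).
have center_u : center s i = u by rewrite /center avg_u pt_u pt_u'; field.
split=> //; first by rewrite /point_flux pt_u.
by rewrite /a_hat center_u pt_u pt_u'; field.
Qed.

Lemma euler_doubly_conservative (R : realType) (f a : R -> R) (dx dt : R)
    (s s' : af_state R) :
  dx != 0 -> dt != 0 -> euler_average_step f a dx dt s s' ->
  doubly_conservative_update (@average R) (point_flux f) (a_hat a) dx dt s s'.
Proof.
move=> dx0 dt0 step i; rewrite step /average_rhs /point_flux.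
(* [subrK] turns [i - 1 + 1] into [i]: both interface fluxes involve [a_hat a s i], whence the
   coefficient -2. *)
by rewrite !diffusion_flux_a_hat // subrK; field; rewrite dx0 dt0.
Qed.

Theorem proposition2p1 (R : realType) (f a : R -> R) (dx : R) (hdx : 0 < dx) :
  consistent f a (@average R) (point_flux f) (a_hat a)
  /\ forall (dt : nat -> R) (s : nat -> af_state R) (n : nat),
       0 < dt n ->
       euler_average_step f a dx (dt n) (s n) (s n.+1) ->
       doubly_conservative_update (@average R) (point_flux f) (a_hat a)
         dx (dt n) (s n) (s n.+1).
Proof.
split=> [|dt s n dt_gt0]; first exact: a_hat_consistent.
by apply: euler_doubly_conservative; apply: lt0r_neq0.
Qed.
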